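(* Let $(P_\alpha)_{\alpha\in A}$ be a net of probability measures on $(\mathcal{F},\mathcal{B}_F)$ and let $P$ be a probability measure on $(\mathcal{F},\mathcal{B}_F)$. Suppose that (i) $P_\alpha \rightarrow_w P$ on $(\mathcal{F}, \tau_{uF})$, (ii) for each $\epsilon>0$ there exists a $K \in \mathcal{K}$ such that $$\liminf_\alpha P_\alpha(\{F \in \mathcal{F}: \emptyset \neq F \subseteq K\}) \ge 1-\epsilon,$$ (iii) $P(\mathbf{F}_{0,1}) = 1$, where $\mathbf{F}_{0,1}=\{\emptyset\}\cup\{\{x\}:x\in E\}$. Then $P_\alpha \rightarrow_w P$ on $(\mathcal{F}, \tau_{F})$.
   Context: $(E,\mathcal{G})$ is a non-empty locally compact, second-countable Hausdorff space; $\mathcal{G}$ is the family of its open sets, and $\mathcal{F}$ and $\mathcal{K}$ are the families of all closed and all compact subsets of $E$. For $A\subseteq E$ put $\mathcal{M}(A)=\{F\in\mathcal{F}: F\cap A=\emptyset\}$ and $\mathcal{H}(A)=\{F\in\mathcal{F}: F\cap A\neq\emptyset\}$. The Fell topology $\tau_F$ on $\mathcal{F}$ is generated by $\{\mathcal{M}(K):K\in\mathcal{K}\}\cup\{\mathcal{H}(G):G\in\mathcal{G}\}$; the upper Fell topology $\tau_{uF}$ on $\mathcal{F}$ is generated by $\{\mathcal{M}(K):K\in\mathcal{K}\}$. Their Borel $\sigma$-algebras coincide: $\mathcal{B}_F:=\sigma(\tau_F)=\sigma(\tau_{uF})$. The sets $\mathbf{F}_{0,1}$ and $\{F\in\mathcal{F}:\emptyset\neq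 F\subseteq K\}$ belong to $\mathcal{B}_F$. Weak convergence: for a topological space $(X,\mathcal{O})$ and a net $(P_\alpha)_{\alpha\in A}$ ($A$ a directed set) of probability measures and a probability measure $P$ on $(X,\sigma(\mathcal{O}))$, $P_\alpha\rightarrow_w P$ on $(X,\mathcal{O})$ means convergence in the weak topology, i.e. the initial topology on the set of probability measures with respect to the maps $P\mapsto P(O)$, $O\in\mathcal{O}$, into $\mathbb{R}$ with the topology $\{(a,\infty):a\in\mathbb{R}\}\cup\{\emptyset,\mathbb{R}\}$. Equivalently: $\liminf_\alpha P_\alpha(O)\ge P(O)$ for all $O\in\mathcal{O}$; equivalently: $\limsup_\alpha P_\alpha(F)\le P(F)$ for all closed sets $F$ of $(X,\mathcal{O})$. *)

(* Defs.v *)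
From HB Require Import structures.
From mathcomp Require Import all_boot all_order all_algebra.
From mathcomp Require Import all_classical all_reals all_analysis.

Set Implicit Arguments.
Unset Strict Implicit.
Unset Printing Implicit Defensive.

Import Order.TTheory GRing.Theory Num.Theory.

Local Open Scope classical_set_scope.
Local Open Scope ring_scope.

Definition closedset (E : topologicalType) : Type := {F : set E | closed F}.

Definition set_of_closedset (E : topologicalType) (F : closedset E) : set E :=
  sval F.
Coercion set_of_closedset : closedset >-> set.

HB.instance Definition _ (E : topologicalType) := gen_eqMixin (closedset E).
HB.instance Definition _ (E : topologicalType) := gen_choiceMixin (closedset E).
HB.instance Definition _ (E : topologicalType) :=
  isPointed.Build (closedset E) (exist _ set0 closed0).

Section Fell.
Variable E : topologicalType.

Definition missing (A : set E) : set (closedset E) :=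
  [set F | (F : set E) `&` A = set0].

Definition hitting (A : set E) : set (closedset E) :=
  [set F | (F : set E) `&` A !=set0].

Definition upper_fell_subbase : set (set (closedset E)) :=
  [set missing K | K in @compact E].

Definition fell_subbase : set (set (closedset E)) :=
  upper_fell_subbase `|` [set hitting G | G in @open E].

Definition fell : Type := closedset E.
HB.instance Definition _ := Pointed.on fell.
HB.instance Definition _ := isSubBaseTopological.Build fell fell_subbase id.

Definition upper_fell : Type := closedset E.
HB.instance Definition _ := Pointed.on upper_fell.
HB.instance Definition _ :=
  isSubBaseTopological.Build upper_fell upper_fell_subbase id.

Definition fell_open : set (set (closedset E)) := @open fell.

Definition upper_fell_open : set (set (closedset E)) := @open upper_fell.

(* The closed subsets of [E] with the Borel sigma-algebra of the Fell topology.
   The upper Fell topology is coarser, so its open sets are measurable here;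
   for [E] locally compact, second-countable and Hausdorff they generate the
   same sigma-algebra. *)
Definition borel_fell : Type := g_sigma_algebraType fell_open.
HB.instance Definition _ := Measurable.on borel_fell.

Definition at_most_singletons : set (closedset E) :=
  [set F | (F : set E) = set0 \/ exists x : E, (F : set E) = [set x]].

Definition nonempty_within (K : set E) : set (closedset E) :=
  [set F | (F : set E) !=set0 /\ (F : set E) `<=` K].

End Fell.
Arguments fell_open : clear implicits.
Arguments upper_fell_open : clear implicits.
Arguments at_most_singletons : clear implicits.

Section Nets.
Context {d : Order.disp_t} (A : preorderType d).

Definition directed : Prop :=
  [set: A] !=set0 /\ forall a b : A, exists c : A, (a <= c)%O /\ (b <= c)%O.

Definition net_tails : set_system A :=
  filter_from [set: A] (fun a => [set b | (a <= b)%O]).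

Definition net_liminf (R : realType) (u : A -> \bar R) : \bar R :=
  ereal_sup [set ereal_inf [set u b | b in [set b | (a <= b)%O]]
            | a in [set: A]].

End Nets.
Arguments net_tails {d} A.

Section WeakTopology.
Context {d : measure_display} {T : measurableType d} {R : realType}.

(* The probability measures on [T] with the initial topology for the maps
   [P |-> P U], [U] in [O], into the reals with the topology of the right rays:
   the preimages of the rays form a subbase. The topology [O] on [T] is explicit
   because one sigma-algebra is used with two topologies. *)
Definition weak_probability (O : set (set T)) : Type := probability T R.

HB.instance Definition _ (O : set (set T)) := Choice.on (weak_probability O).
HB.instance Definition _ (O : set (set T)) :=
  isSubBaseTopological.Build (weak_probability O)
    [set [set P : probability T R | (a%:E < P U)%E]
    | a in [set: R] & U in O] id.

Definition weak_cvg {dA : Order.disp_t} {A : preorderType dA}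
    (Pa : A -> probability T R) (P : probability T R) (O : set (set T))
    : Prop :=
  (Pa : A -> weak_probability O) @ net_tails A --> (P : weak_probability O).

End WeakTopology.

(* Main.v *)
Require Import Defs.
From mathcomp Require Import all_boot all_order all_algebra.
From mathcomp Require Import all_classical all_reals all_analysis.
From mathcomp Require Import lra.

Set Implicit Arguments.
Unset Strict Implicit.
Unset Printing Implicit Defensive.

Import Order.TTheory GRing.Theory Num.Theory.

Local Open Scope classical_set_scope.
Local Open Scope ring_scope.

(** Let [O] be open in the Fell topology and [K] compact. If the singleton [{x}]
    lies in [O], then [x] has an open neighbourhood [G] such that every nonempty
    closed set inside [G] lies in [O] ([singleton_fell_nbhs]). Hence every
    nonempty closed subset of [K] that misses the compact set [K `\` G] lies in
    [O], and so does [{x}]. Let [core K O] be the union of all [missing L] with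
    [L] compact such that the nonempty closed subsets of [K] missing [L] belong
    to [O]. This set is open in the upper Fell topology, it contains every point
    of [O] that is empty or a singleton (for the empty set take [L = K]), and its
    trace on [nonempty_within K] is contained in [O]. Therefore
    [P O <= P (core K O)], since [P] is carried by the sets with at most one
    point, whereas [Pa a (core K O) <= Pa a O + (1 - Pa a (nonempty_within K))].
    By tightness the last term is eventually as small as desired, and the
    convergence for [core K O] gives the convergence for [O].

    In a Hausdorff space [nonempty_within K] and [at_most_singletons] are
    Borel: the first is the difference of the hitting sets of the whole space
    and of the complement of [K]; the second is Fell closed, because
    distinct points have disjoint open neighbourhoods. *)

(** * Topologies given by a subbase *)

(** The topology generated by [S]: unions of finite intersections of members. *)
Definition subbase_topology (T : choiceType) (S : set (set T)) : set (set T) :=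
  [set \bigcup_(B in D) B | D in subset^~ (finI_from S id)].

Lemma subbase_topology_sub (T : choiceType) (S : set (set T)) :
  S `<=` subbase_topology S.
Proof.
move=> U SU; exists [set U]; last by rewrite bigcup_set1.
by move=> _ ->; exact: finI_from1.
Qed.

(** A filter converges to [p] as soon as it contains the subbasic neighbourhoods
    of [p]. *)
Lemma subbase_cvg (T : choiceType) (S : set (set T)) (p : T)
    (Phi : set_system T) : Filter Phi ->
  (forall B, S B -> B p -> Phi B) ->
  forall U, subbase_topology S U -> U p -> Phi U.
Proof.
move=> PhiF PhiS _ [D DS <-] [B DB Bp].
suff PhiB : Phi B by apply: filterS PhiB => q Bq; exists B.
have [I IS IB] := DS B DB.
rewrite -IB; apply: filter_bigI => C IC.
apply: PhiS; first by have /= /[!inE] := IS C IC.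
by move: Bp; rewrite -IB; exact.
Qed.

Lemma fell_openE (E : topologicalType) :
  fell_open E = subbase_topology (@fell_subbase E).
Proof. by []. Qed.

Lemma upper_fell_openE (E : topologicalType) :
  upper_fell_open E = subbase_topology (@upper_fell_subbase E).
Proof. by []. Qed.

Lemma upper_fell_open_fell (E : topologicalType) :
  upper_fell_open E `<=` fell_open E.
Proof.
move=> _ [D DS <-]; exists D => // B /DS[I IS IB].
by exists I => // C /IS /[!inE] ?; left.
Qed.

Lemma fell_open_bigcup (E : topologicalType) I (D : set I)
    (f : I -> set (closedset E)) :
  (forall i, D i -> fell_open E (f i)) -> fell_open E (\bigcup_(i in D) f i).
Proof. exact: (@bigcup_open (fell E)). Qed.

Lemma upper_fell_open_bigcup (E : topologicalType) I (D : set I)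
    (f : I -> set (closedset E)) :
  (forall i, D i -> upper_fell_open E (f i)) ->
  upper_fell_open E (\bigcup_(i in D) f i).
Proof. exact: (@bigcup_open (upper_fell E)). Qed.

Lemma fell_open_hitting (E : topologicalType) (G : set E) :
  open G -> fell_open E (hitting G).
Proof.
by move=> oG; rewrite fell_openE; apply: subbase_topology_sub; right; exists G.
Qed.

Lemma upper_fell_open_missing (E : topologicalType) (K : set E) :
  compact K -> upper_fell_open E (missing K).
Proof.
by move=> cK; rewrite upper_fell_openE; apply: subbase_topology_sub; exists K.
Qed.

(** * Nets of probability measures *)

Lemma net_tails_filter (d : Order.disp_t) (A : preorderType d) :
  directed A -> Filter (net_tails A).
Proof.
move=> [[a _] dirA]; apply: filter_from_filter; first by exists a.
move=> b c _ _; have [e [be ce]] := dirA b c; exists e => // x /= ex.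
by split; apply: le_trans ex.
Qed.

(** The description of weak convergence by open sets: the lower limit of the
    masses of an open set is at least its limit mass. *)
Lemma weak_cvgP (d : measure_display) (T : measurableType d) (R : realType)
    (dA : Order.disp_t) (A : preorderType dA) (O : set (set T))
    (Pa : A -> probability T R) (P : probability T R) : directed A ->
  weak_cvg Pa P O <-> forall U, O U -> forall r : R, (r%:E < P U)%E ->
    \forall a \near net_tails A, (r%:E < Pa a U)%E.
Proof.
move=> dirA; have tailsF := net_tails_filter dirA.
split=> [PaP U OU r rPU | PaP V].
  pose B := [set Q : weak_probability O | (r%:E < Q U)%E].
  have oB : @open (weak_probability (R := R) O) B.
    by apply: subbase_topology_sub; exists r => //; exists U.
  exact: (PaP B (open_nbhs_nbhs (conj oB rPU))).
rewrite nbhsE => -[B [oB BP] BV].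
apply: (filterS BV); move: oB BP.
apply: (@subbase_cvg (weak_probability (R := R) O)).
by move=> _ [r _ [U OU <-]]; exact: PaP.
Qed.

Lemma lt_net_liminf (d : Order.disp_t) (A : preorderType d) (R : realType)
    (u : A -> \bar R) (x : \bar R) :
  (x < net_liminf u)%E -> \forall a \near net_tails A, (x < u a)%E.
Proof.
move=> /ereal_sup_gt[_ [a _ <-] xa]; exists a => // b ab.
by apply: lt_le_trans xa _; apply: ereal_inf_lbound; exists b.
Qed.

(** If [U] is contained in [V] inside the set [C], then [P U] exceeds [P V] by at
    most the mass of the complement of [C]. *)
Lemma probability_le_trace (d : measure_display) (T : measurableType d)
    (R : realType) (P : probability T R) (U V C : set T) :
  measurable U -> measurable V -> measurable C -> U `&` C `<=` V ->
  (P U <= P V + (1 - P C))%E.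
Proof.
move=> mU mV mC UCV; rewrite -probability_setC//.
have mC' : measurable (~` C) by exact: measurableC.
apply: le_trans (measureU2 _ mV mC'); apply: le_measure; rewrite ?inE//.
  exact: measurableU.
by move=> x Ux; have [Cx|] := pselect (C x); [left; exact: UCV | right].
Qed.

(** * Borel sets of closed sets *)

Lemma fell_open_measurable (E : topologicalType) (U : set (closedset E)) :
  fell_open E U -> measurable (U : set (borel_fell E)).
Proof. exact: sub_gen_smallest. Qed.

Lemma nonempty_within_measurable (E : topologicalType) (K : set E) :
  closed K -> measurable (nonempty_within K : set (borel_fell E)).
Proof.
move=> cK.
have -> : nonempty_within K = hitting [set: E] `\` hitting (~` K).
  apply/seteqP; split=> F [] /=; rewrite /hitting /= setIT => F0 FK.
    by split=> // -[x [Fx]]; apply; exact: FK.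
  by split=> // x Fx; apply: contrapT => Kx; apply: FK; exists x.
apply: measurableD; apply: fell_open_measurable; apply: fell_open_hitting.
  exact: openT.
exact: closed_openC.
Qed.

Lemma at_most_singletons_measurable (E : topologicalType) :
  hausdorff_space E ->
  measurable (at_most_singletons E : set (borel_fell E)).
Proof.
rewrite open_hausdorff => hE; rewrite -[X in measurable X]setCK.
apply: measurableC; apply: fell_open_measurable.
pose D := [set GH : set E * set E |
  [/\ open GH.1, open GH.2 & GH.1 `&` GH.2 = set0]].
have -> : ~` at_most_singletons E =
    \bigcup_(GH in D) (hitting GH.1 `&` hitting GH.2).
  apply/seteqP; split=> F.
    move=> F2; have [x Fx] : (F : set E) !=set0.
      by apply/set0P/eqP => F0; apply: F2; left.
    have [y Fy yx] : exists2 y, (F : set E) y & x != y.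
      apply: contrapT => nF; apply: F2; right; exists x.
      apply/seteqP; split=> [y Fy /=|_ ->//].
      by apply: contrapT => yx; apply: nF; exists y => //; apply/eqP => /esym.
    have [[G H]/= [/[!inE] Gx Hy] [oG oH GH]] := hE _ _ yx.
    exists (G, H); last by split; [exists x | exists y].
    by split=> //; exact/eqP.
  move=> [[G H]/= [_ _ GH] [[x [Fx Gx]] [y [Fy Hy]]]] [F0|[z Fz]].
    by move: Fx; rewrite F0.
  move: Fx Fy; rewrite Fz /= => xz yz.
  suff : set0 z by [].
  by rewrite -GH; split; [rewrite -xz | rewrite -yz].
apply: fell_open_bigcup => -[G H] [oG oH _].
by apply: (@openI (fell E)); exact: fell_open_hitting.
Qed.

(** * The upper Fell open core of a Fell open set *)

(** The sets [nonempty_within G], for open [G] shrinking to [x], converge to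
    [{x}] in the Fell topology. *)
Lemma singleton_fell_nbhs (E : topologicalType) (O : set (closedset E))
    (F : closedset E) (x : E) : hausdorff_space E -> fell_open E O ->
  (F : set E) = [set x] -> O F ->
  exists2 G : set E, open_nbhs x G & nonempty_within G `<=` O.
Proof.
move=> hE; rewrite fell_openE => oO Fx OF.
pose Phi := filter_from (open_nbhs x) (@nonempty_within E).
have PhiF : Filter Phi.
  apply: filter_from_filter; first by exists setT; split=> //; exact: openT.
  move=> G H xG xH; exists (G `&` H); first exact: open_nbhsI.
  by move=> C [C0 CGH]; split; split=> // y /CGH[].
suff subPhi B : fell_subbase B -> B F -> Phi B.
  exact: (subbase_cvg PhiF subPhi oO OF).
move=> [[K cK <-]|[G oG <-]].
  rewrite /missing /= Fx => xK; exists (~` K).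
    split; first by apply: closed_openC; exact: compact_closed.
    by move=> Kx; suff: set0 x by []; rewrite -xK.
  by move=> C [_ CK]; rewrite /missing /= -subset0 => y [/CK].
rewrite /hitting /= Fx => -[_ [-> Gx]]; exists G => // C [[y Cy] CG].
by exists y; split=> //; exact: CG.
Qed.

(** The closed sets [F] missing some compact [L] such that every nonempty
    closed subset of [K] missing [L] belongs to [O]. *)
Definition core (E : topologicalType) (K : set E) (O : set (closedset E)) :
    set (closedset E) :=
  \bigcup_(L in [set L | compact L /\ missing L `&` nonempty_within K `<=` O])
    missing L.

Lemma core_open (E : topologicalType) (K : set E) (O : set (closedset E)) :
  upper_fell_open E (core K O).
Proof.
by apply: upper_fell_open_bigcup => L [cL _]; exact: upper_fell_open_missing.
Qed.

Lemma core_within_sub (E : topologicalType) (K : set E)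
    (O : set (closedset E)) : core K O `&` nonempty_within K `<=` O.
Proof. by move=> F [[L [_ LO] LF] KF]; exact: LO. Qed.

Lemma sub_core (E : topologicalType) (K : set E) (O : set (closedset E)) :
  hausdorff_space E -> compact K -> fell_open E O ->
  O `&` at_most_singletons E `<=` core K O.
Proof.
move=> hE cK oO F [OF [F0|[x Fx]]].
  exists K; last by rewrite /missing /= F0 set0I.
  split=> // C [CK [[y Cy] sCK]].
  by suff: set0 y by []; rewrite -CK; split=> //; exact: sCK.
have [G [oG Gx] GO] := singleton_fell_nbhs hE oO Fx OF.
exists (K `\` G); last first.
  by rewrite /missing /= Fx -subset0 => _ [-> []].
split; first by apply: compact_closedI => //; exact: open_closedC.
move=> C [CKG [C0 CK]]; apply: GO; split=> // y Cy.
apply: contrapT => Gy; suff: set0 y by [].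
by rewrite -CKG; split=> //; split=> //; exact: CK.
Qed.

Theorem theorem4 (R : realType) (E : topologicalType)
    (E_nonempty : [set: E] !=set0)
    (E_locally_compact : locally_compact [set: E])
    (E_second_countable : @second_countable E)
    (E_hausdorff : hausdorff_space E)
    (dA : Order.disp_t) (A : preorderType dA) (A_directed : directed A)
    (Pa : A -> probability (borel_fell E) R) (P : probability (borel_fell E) R)
    (upper_cvg : weak_cvg Pa P (upper_fell_open E))
    (tight : forall eps : R, 0 < eps -> exists K : set E, compact K /\
       ((1 - eps)%:E <= net_liminf (fun a => Pa a (nonempty_within K)))%E)
    (P_singletons : P (at_most_singletons E) = 1%E) :
  weak_cvg Pa P (fell_open E).
Proof.
apply/(weak_cvgP _ _ _ A_directed) => O oO r rPO.
have tailsF := net_tails_filter A_directed.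
have mO := fell_open_measurable oO.
have POfin : P O \is a fin_num by exact: fin_num_measure.
(* The bounds [r + 2 * e < Pa a (core K O)] and
   [1 - 2 * e < Pa a (nonempty_within K)] add up to [r < Pa a O]; the division
   by [3] leaves room for the strict inequality [r + 2 * e < P O]. *)
pose e := (fine (P O) - r) / 3.
have e0 : 0 < e.
  by rewrite divr_gt0 ?subr_gt0// -lte_fin fineK.
have [K [cK tightK]] := tight e e0.
have oU : upper_fell_open E (core K O) by exact: core_open.
have mU := fell_open_measurable (upper_fell_open_fell oU).
have mN := nonempty_within_measurable (compact_closed E_hausdorff cK).
have POU : (P O <= P (core K O))%E.
  have := probability_le_trace P mO mU
    (at_most_singletons_measurable E_hausdorff) (sub_core E_hausdorff cK oO).
  by rewrite P_singletons subee// adde0.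
have rU : ((r + 2 * e)%:E < P (core K O))%E.
  apply: lt_le_trans POU; rewrite -(fineK POfin) lte_fin.
  by rewrite /e; move: e0; rewrite /e; lra.
have tightU : \forall a \near net_tails A,
    ((1 - 2 * e)%:E < Pa a (nonempty_within K))%E.
  by apply: lt_net_liminf; apply: lt_le_trans tightK; rewrite lte_fin; lra.
have cvgU := (weak_cvgP _ _ _ A_directed).1 upper_cvg _ oU _ rU.
apply: filterS2 cvgU tightU => a aU aN.
have := probability_le_trace (Pa a) mU mO mN
  (@core_within_sub E K O).
move: aU aN.
rewrite -(fineK (fin_num_measure (Pa a) _ mU)).
rewrite -(fineK (fin_num_measure (Pa a) _ mN)).
rewrite -(fineK (fin_num_measure (Pa a) _ mO)).
rewrite -EFinB -EFinD !lte_fin lee_fin; lra.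
Qed.
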